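(* Let $V$ be a real vector space with dual $V^\vee$, let $\alpha,\beta\in V$, $\alpha^\vee,\beta^\vee\in V^\vee$ with $\alpha^\vee(\alpha)=\beta^\vee(\beta)=2$ and $\alpha^\vee(\beta)=\beta^\vee(\alpha)<0$, and put $\rho=-\frac12\alpha^\vee(\beta)=-\frac12\beta^\vee(\alpha)$. Let $n$ be a positive integer. If $\rho\ge\cos\frac{\pi}{n}$, then for every continuous path $\pi:[0,T]\to V$ with $\pi(0)=0$ and every $t\in[0,T]$, $$(\underbrace{\mathcal P_\alpha\mathcal P_\beta\mathcal P_\alpha\cdots}_{n\text{ terms}})\pi(t)=\pi(t)-\inf_{t\ge s_0\ge s_1\ge\cdots\ge s_{n-1}\ge 0}\Bigl(\sum_{i=0}^{n-1}T_i(\rho)Z^{(i)}(s_i)\Bigr)\alpha-\inf_{t\ge s_0\ge s_1\ge\cdots\ge s_{n-2}\ge 0}\Bigl(\sum_{i=0}^{n-2}T_i(\rho)Z^{(i+1)}(s_i)\Bigr)\beta .$$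
   Context: The Pitman transform attached to $(\alpha,\alpha^\vee)$ acts on continuous paths $\pi:[0,T]\to V$ with $\pi(0)=0$ by $\mathcal P_\alpha\pi(t)=\pi(t)-\inf_{0\le s\le t}\alpha^\vee(\pi(s))\,\alpha$; $\mathcal P_\beta$ is defined similarly from $(\beta,\beta^\vee)$. Products are compositions of maps (the rightmost factor acts first). Put $X(s)=\alpha^\vee(\pi(s))$, $Y(s)=\beta^\vee(\pi(s))$, and $Z^{(k)}=X$ if $k$ is even, $Z^{(k)}=Y$ if $k$ is odd. The $T_k$ are the Tchebycheff polynomials defined by $T_0(x)=1$, $T_1(x)=2x$ and $2xT_k(x)=T_{k-1}(x)+T_{k+1}(x)$ for $k\ge1$. For $n=1$ the $\beta$-term is an empty sum, i.e. $0$. (The equality $\alpha^\vee(\beta)=\beta^\vee(\alpha)$ is the paper's standing normalization for this result, since replacing $(\alpha,\alpha^\vee)$ by $(\lambda\alpha,\alpha^\vee/\lambda)$, $\lambda>0$, does not change $\mathcal P_\alpha$.) *)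

(* Defs.v *)
From HB Require Import structures.
From mathcomp Require Import all_boot all_order all_algebra.
From mathcomp Require Import all_classical all_reals all_analysis.

Set Implicit Arguments.
Unset Strict Implicit.
Unset Printing Implicit Defensive.

Import Order.TTheory GRing.Theory Num.Theory.
Import numFieldNormedType.Exports.

Local Open Scope classical_set_scope.
Local Open Scope ring_scope.

(* Paths [0, T] -> V are represented by total functions R -> V; for t in
   [0, T] the value at t of every transform below depends only on the
   restriction of the path to [0, t]. *)
Definition pitman (R : realType) (V : lmodType R) (a : V)
    (av : {linear V -> R^o}) (p : R -> V) : R -> V :=
  fun t => p t - inf [set (av (p s) : R) | s in `[0, t]] *: a.

(* f \o g \o f \o ... with n factors *)
Fixpoint altcomp (T : Type) (n : nat) (f g : T -> T) : T -> T :=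
  if n is m.+1 then f \o altcomp m g f else id.

(* This normalization (first values 1 and 2x) is that of the second kind. *)
Fixpoint tcheb (R : realType) (k : nat) : {poly R} :=
  match k with
  | 0 => 1
  | k1.+1 => match k1 with
             | 0 => 2%:R *: 'X
             | k2.+1 => 2%:R *: 'X * tcheb R k1 - tcheb R k2
             end
  end.

Definition altfun (R : realType) (X Y : R -> R) (k : nat) : R -> R :=
  if odd k then Y else X.

(* the m-tuples t >= s_0 >= ... >= s_(m-1) >= 0; for m = 0 and t >= 0 this is
   the singleton of the empty tuple *)
Definition chains (R : realType) (m : nat) (t : R) : set (m.-tuple R) :=
  [set s : m.-tuple R | path >=%R t (rcons s 0)].
Arguments chains {R} m t _.

Definition cheb_inf (R : realType) (m : nat) (rho : R) (Z : nat -> R -> R)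
    (t : R) : R :=
  inf [set \sum_(i < m) (tcheb R i).[rho] * Z i (tnth s i) | s in chains m t].

(* Main.v *)
(* Write C, B, A for the infima over chains of lengths n+2, n, and (with X and Y
   exchanged) n+1.  By induction on n everything reduces to
     inf_(s <= t) (X(s) + 2 rho A(s) - 2 B(s)) = C(t) - B(t).
   Expanding 2 rho T_i = T_(i-1) + T_(i+1), the sum X(s_0) + 2 rho A(s_1, ...)
   over a chain s equals the sum defining C over s plus the one defining B over
   the chain (s_2, s_3, ...).
   For >=, pointwise maximum and minimum turn two chains into two chains with the
   same total sum.  For <=, one looks at a point where B - C increases to its
   value at t: there a minimizing chain s of C and a minimizing chain u of B
   cannot exchange initial segments, so u_j < s_(j+1) for all j; hence every
   tail of s may be replaced by the tail of u, which gives inequalities that sum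
   up (by Abel summation, T_i / T_(i+2) being nondecreasing in i) to
   B(s_2, s_3, ...) <= B(u).  The condition rho >= cos (pi / n) is used through
   the positivity of the T_i.  Minimizers are only taken up to an error. *)
Require Import Defs.
From HB Require Import structures.
From mathcomp Require Import all_boot all_order all_algebra.
From mathcomp Require Import all_classical all_reals all_analysis.
From mathcomp Require Import zify ring lra.

Set Implicit Arguments.
Unset Strict Implicit.
Unset Printing Implicit Defensive.

Import Order.TTheory GRing.Theory Num.Theory.
Import numFieldNormedType.Exports.

Local Open Scope classical_set_scope.
Local Open Scope ring_scope.

(** * Infima of weighted sums over decreasing chains *)

Section Chains.
Variable R : realType.
Implicit Types (m n : nat) (t T e : R) (c : nat -> R) (Z : nat -> R -> R).
Implicit Types s u : nat -> R.

(* Chains are padded with zeros, so that chains of different lengths can be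
   spliced together. *)
Definition chain m t s : Prop :=
  [/\ s 0%N <= t, forall i, 0 <= s i, forall i, s i.+1 <= s i
    & forall i, (m <= i)%N -> s i = 0].

Definition chain_sum m c Z s : R := \sum_(0 <= i < m) c i * Z i (s i).

Definition chain_inf m c Z t : R :=
  inf [set chain_sum m c Z s | s in chain m t].

Lemma chain_le m t s i : chain m t s -> s i <= t.
Proof. by case=> s0 _ sS _; elim: i => // i; exact: le_trans. Qed.

Lemma chain0 m s : chain m 0 s -> forall i, s i = 0.
Proof.
by move=> cs i; apply/le_anti; rewrite (chain_le i cs); case: cs => _ ->.
Qed.

Lemma chain_cst0 m t : 0 <= t -> chain m t (fun=> 0).
Proof. by split. Qed.

Lemma chain_min m t t' s : 0 <= t' -> chain m t s ->
  chain m t' (fun i => Num.min (s i) t').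
Proof.
move=> t'0 [s0 s_ge0 sS sm]; split => [|i|i|i im].
- by rewrite ge_min lexx orbT.
- by rewrite le_min s_ge0.
- by rewrite le_min !ge_min sS lexx orbT.
- by rewrite sm// min_l.
Qed.

Lemma chain_shift m t s : chain m.+1 t s -> chain m (s 0%N) (s \o S).
Proof. by case=> s0 s_ge0 sS sm; split => //= i im; rewrite sm. Qed.

Lemma chain_cons m t s : 0 <= t -> chain m t s ->
  chain m.+1 t (fun i => if i is j.+1 then s j else t).
Proof.
move=> t0 cs; have := cs; case=> s0 s_ge0 sS sm; split=> //.
- by case.
- by case.
- by case=> // i im; exact: sm.
Qed.

(** Both sides contain the same terms at each index; no swap may occur from [m] on, where only the
    longer sum has a term. *)
Lemma chain_sum_swap m n c Z (b : nat -> bool) s u : (m <= n)%N ->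
  (forall i, (m <= i)%N -> b i = false) ->
  chain_sum n c Z (fun i => if b i then u i else s i) +
  chain_sum m c Z (fun i => if b i then s i else u i) =
  chain_sum n c Z s + chain_sum m c Z u.
Proof.
move=> mn bm; rewrite /chain_sum.
rewrite (big_cat_nat (leq0n m) mn)//= [in RHS](big_cat_nat (leq0n m) mn)//= addrAC.
rewrite [in RHS]addrAC -!big_split/=; congr (_ + _).
  by apply: eq_bigr => i _; case: (b i) => //; rewrite addrC.
by apply: eq_big_nat => i /andP[mi _]; rewrite bm.
Qed.

Section Bounded.
Variables (c : nat -> R) (Z : nat -> R -> R) (T : R).
Hypothesis Zbnd : forall i, exists M, forall x, 0 <= x <= T -> `|Z i x| <= M.

Lemma chain_inf_has_lbound m t : t <= T ->
  has_lbound [set chain_sum m c Z s | s in chain m t].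
Proof.
move=> tT; have [M MZ] := choice Zbnd.
exists (- \sum_(0 <= i < m) `|c i| * M i) => _ [s cs <-].
rewrite -sumrN; apply: ler_sum => i _.
rewrite lerNl (le_trans (ler_norm _))// normrN normrM ler_wpM2l// MZ//.
by rewrite (le_trans (chain_le i cs))//; case: cs => _ ->.
Qed.

Lemma chain_inf_le m t s : t <= T -> chain m t s ->
  chain_inf m c Z t <= chain_sum m c Z s.
Proof.
by move=> tT cs; apply: ge_inf; [exact: chain_inf_has_lbound|exists s].
Qed.

Lemma chain_inf_adherent m t e : 0 <= t <= T -> 0 < e ->
  exists2 s, chain m t s & chain_sum m c Z s < chain_inf m c Z t + e.
Proof.
move=> /andP[t0 tT] e0.
have [|_ [s cs <-] se] := @inf_adherent _
    [set chain_sum m c Z s | s in chain m t] _ e0; last by exists s.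
split; last exact: chain_inf_has_lbound.
by eexists; exists (fun=> 0) => //; exact: chain_cst0.
Qed.

Lemma chain_inf0 m : (forall i, Z i 0 = 0) -> chain_inf m c Z 0 = 0.
Proof.
move=> Z0; rewrite /chain_inf [X in inf X](_ : _ = [set 0]) ?inf1//.
apply/seteqP; split => [_ [s cs <-]|_ ->] /=.
  by rewrite /chain_sum big1// => i _; rewrite (chain0 cs) Z0 mulr0.
exists (fun=> 0); first exact: chain_cst0.
by rewrite /chain_sum big1// => i _; rewrite Z0 mulr0.
Qed.

(* Pointwise maximum and minimum turn a pair of chains into a pair of chains
   with the same total value. *)
Lemma chain_inf_maxmin m n t t' s u : (m <= n)%N -> t <= t' -> t' <= T ->
  chain n t s -> chain m t' u ->
  chain_inf n c Z t' + chain_inf m c Z t <=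
  chain_sum n c Z s + chain_sum m c Z u.
Proof.
move=> mn tt' t'T cs cu; have tT := le_trans tt' t'T.
have [s0 s_ge0 sS sn] := cs; have [u0 u_ge0 uS um] := cu.
rewrite -(@chain_sum_swap _ _ _ _ (fun i => s i < u i))//; last first.
  by move=> i mi; rewrite um// ltNge s_ge0.
apply: lerD; apply: chain_inf_le => //; split=> [|i|i|i ni].
- by rewrite -[X in X <= _]/(Num.max _ _) ge_max u0 (le_trans s0).
- by case: ifP.
- by rewrite -![if _ then _ else _]/(Num.max _ _) ge_max !le_max sS uS orbT.
- by rewrite um ?(leq_trans mn)// sn// ltxx.
- by rewrite -[X in X <= _]/(Num.min _ _) ge_min s0.
- by case: ifP.
- by rewrite -![if _ then _ else _]/(Num.min _ _) le_min !ge_min sS uS orbT.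
- by rewrite um// ltNge s_ge0.
Qed.

(* If the two chains interlaced at some place they could exchange their initial
   segments. *)
Lemma chain_interlace m t t' s u : t' <= t -> t <= T ->
  chain m.+2 t s -> chain m t' u -> t' < s 0%N ->
  chain_sum m.+2 c Z s + chain_sum m c Z u <
    chain_inf m.+2 c Z t' + chain_inf m c Z t ->
  forall j, (j < m)%N -> u j < s j.+1.
Proof.
move=> t't tT cs cu s0t' lt_su; have t'T := le_trans t't tT.
have [s0 s_ge0 sS sm] := cs; have [u0 u_ge0 uS um] := cu.
have swap j : (j < m)%N -> u j.+1 <= s j -> u j < s j.+1.
  (* Otherwise [s] and [u] can swap their entries up to index [j]: this gives a chain of length
     [m.+2] below [t'] and one of length [m] below [t], whose total contradicts [lt_su]. *)
  move=> jm us; rewrite ltNge; apply: contraTN lt_su => su; rewrite -leNgt.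
  rewrite -(@chain_sum_swap _ _ _ _ (fun i => i <= j)%N)//; [|lia|lia].
  apply: lerD; apply: chain_inf_le => //; split=> [//|i|i|i ni].
  - by case: ifP.
  - case: (ltngtP i j) => ij //=; by rewrite ?ij ?uS ?sS// ltnW.
  - by rewrite leqNgt (leq_trans jm) ?sm//; lia.
  - by case: ifP.
  - case: (ltngtP i j) => ij //=; by rewrite ?ij ?uS ?sS// ltnW.
  - by rewrite leqNgt (leq_trans jm) ?um//; lia.
elim=> [|j ih] jm; apply: swap => //.
  by rewrite (le_trans (uS _))// (le_trans u0)// ltW.
by rewrite (le_trans (uS _))// (le_trans (uS _))// ltW// ih// ltnW.
Qed.


Lemma chain_inf_anti m t t' : 0 <= t -> t <= t' -> t' <= T ->
  chain_inf m c Z t' <= chain_inf m c Z t.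
Proof.
move=> t0 tt' t'T; apply: lb_le_inf.
  by eexists; exists (fun=> 0) => //; exact: chain_cst0.
move=> _ [s [s0 ? ? ?] <-]; apply: chain_inf_le => //.
by split => //; exact: le_trans tt'.
Qed.

End Bounded.

Lemma chain_sum_min m c Z s t' e :
  (forall i, `|Z i (Num.min (s i) t') - Z i (s i)| <= e) ->
  chain_sum m c Z (fun i => Num.min (s i) t') <=
    chain_sum m c Z s + (\sum_(0 <= i < m) `|c i|) * e.
Proof.
move=> Ze; rewrite mulr_suml -big_split/=; apply: ler_sum => i _.
rewrite -lerBlDl -mulrBr (le_trans (ler_norm _))// normrM.
by rewrite ler_wpM2l.
Qed.

(** By induction the tail is bounded with factor [v 1%N], hence so is the whole sum; lowering this
    factor to [v 0%N] costs at most [(v 1%N - v 0%N) * e], because the whole sum is at least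
    [- e]. *)
Lemma abel_ge m (a b d v : nat -> R) e :
  (forall i, (i < m)%N -> v i <= v i.+1) ->
  (forall i, (i < m)%N -> b i = v i.+1 * a i) ->
  v m * a m <= b m -> 0 <= d m ->
  (forall k, (k <= m)%N -> - e <= \sum_(k <= i < m.+1) a i * d i) ->
  v 0%N * (\sum_(0 <= i < m.+1) a i * d i) - (v m - v 0%N) * e <=
    \sum_(0 <= i < m.+1) b i * d i.
Proof.
elim: m a b d v => [|m ih] a b d v vS bE bm dm sum_ge.
  by rewrite !big_nat1 subrr mul0r subr0 mulrA ler_wpM2r.
have {}ih : v 1%N * (\sum_(0 <= i < m.+1) a i.+1 * d i.+1) -
    (v m.+1 - v 1%N) * e <= \sum_(0 <= i < m.+1) b i.+1 * d i.+1.
  apply: (ih (a \o S) (b \o S) (d \o S) (v \o S)) => //= i im.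
  - exact: vS.
  - exact: bE.
  - by have := sum_ge i.+1 im; rewrite big_add1.
have := sum_ge 0%N isT; have := vS 0%N isT.
rewrite ![\sum_(0 <= i < m.+2) _]big_nat_recl// bE//.
move: ih; set A := \sum_(_ <= _ < _) _; set B := \sum_(_ <= _ < _) _.
move=> ih v01 Ae.
have : 0 <= (v 1%N - v 0%N) * (a 0%N * d 0%N + A + e).
  by rewrite mulr_ge0// ?subr_ge0//; lra.
lra.
Qed.

(** A substitute for the intermediate value theorem without continuity: [z] is the supremum of the
    points where [f] is at most [y], and points arbitrarily close to it straddle the level [y]. *)
Lemma jump_point (f : R -> R) t y : 0 <= t ->
  (forall x x', 0 <= x -> x <= x' -> x' <= t -> f x <= f x') ->
  f 0 <= y -> y < f t ->
  exists2 z, 0 <= z <= t & forall e, 0 < e -> exists x x',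
    [/\ 0 <= x, x <= x', x' <= t, `|x - z| < e & `|x' - z| < e] /\
    f x <= y < f x'.
Proof.
move=> t0 f_mono f0y yft.
pose S := [set x | 0 <= x <= t /\ f x <= y].
have S0 : S 0 by split=> //; rewrite lexx.
have ubS : ubound S t by move=> x [/andP[]].
have supS : has_sup S by split; [exists 0|exists t].
have z0 : 0 <= sup S by apply: ub_le_sup => //; exact: (proj2 supS).
have zt : sup S <= t by apply: ge_sup => //; exists 0.
exists (sup S); first by rewrite z0.
move=> e e0; have [x Sx xz] := sup_adherent e0 supS.
have xleS : x <= sup S by apply: ub_le_sup => //; exact: (proj2 supS).
have [/andP[x0 xt] fxy] := Sx.
pose x' := Num.min t (sup S + e / 2).
have zx' : sup S <= x' by rewrite le_min zt/=; lra.
have x't : x' <= t by rewrite ge_min lexx.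
have x'e : x' <= sup S + e / 2 by rewrite ge_min lexx orbT.
exists x, x'; split.
  by split=> //; rewrite ?ltr_norml; lra.
rewrite fxy/= ltNge; apply/negP => fx'y.
have : x' <= sup S.
  apply: ub_le_sup; first exact: (proj2 supS).
  by split => //; rewrite x't (le_trans z0).
rewrite ge_min => /orP[tz|]; last by lra.
have /min_l x'E : t <= sup S + e / 2 by lra.
by move: fx'y; rewrite /x' x'E leNgt yft.
Qed.

Lemma within_itv_dist (f : R -> R) T z e : {within `[0, T], continuous f} ->
  0 <= z <= T -> 0 < e ->
  exists2 d, 0 < d & forall x, 0 <= x <= T -> `|x - z| < d -> `|f x - f z| < e.
Proof.
move=> fc zT e0.
have /subspace_continuousP/(_ z) := fc.
rewrite /= in_itv/= => /(_ zT) /cvgrPdist_lt/(_ e e0).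
rewrite near_withinE => -[d /= d0 df]; exists d => // x xT xz.
by rewrite distrC; apply: df; rewrite /= ?in_itv//= distrC.
Qed.

Lemma within_itv_bounded (f : R -> R) T : {within `[0, T], continuous f} ->
  exists M, forall x, 0 <= x <= T -> `|f x| <= M.
Proof.
move=> fc; have [T0|T0] := leP 0 T; last first.
  exists 0 => x /andP[x0 xT].
  by have := le_lt_trans (le_trans x0 xT) T0; rewrite ltxx.
have [a _ fa] := EVT_min T0 fc; have [b _ fb] := EVT_max T0 fc.
exists (`|f a| + `|f b|) => x xT; rewrite ler_norml.
have := fa x; have := fb x; rewrite in_itv/= => /(_ xT) + /(_ xT).
have := ler_norm (f b); have := ler_norm (- f a); rewrite normrN.
have := normr_ge0 (f b); have := normr_ge0 (f a); lra.
Qed.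

End Chains.

(** * The recursion step *)

Section Chebyshev.
Variables (R : realType) (rho : R) (c : nat -> R).
Hypotheses (rho_ge0 : 0 <= rho) (c0 : c 0%N = 1) (c1 : c 1%N = 2 * rho)
  (cSS : forall i, c i.+2 = 2 * rho * c i.+1 - c i).
Implicit Types (Z : nat -> R -> R) (t T e : R).

(** A Turan-type inequality: the difference of the two sides is constantly [2 * rho]. It makes the
    ratios [c i / c i.+2] nondecreasing where the denominators are positive. *)
Lemma cheb_turan i : c i * c i.+3 <= c i.+1 * c i.+2.
Proof.
suff -> : c i.+1 * c i.+2 = c i * c i.+3 + 2 * rho.
  by rewrite lerDl mulr_ge0.
elim: i => [|i ih]; first by rewrite !cSS c1 c0; ring.
have : c i.+2 * c i.+3 = (2 * rho * c i.+1 - c i) * c i.+3 by rewrite -cSS.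
by rewrite (cSS i.+2); lra.
Qed.

(** The shift by one with initial value [0] makes the terms in [v 0%N] of [abel_ge] vanish. *)
Definition cheb_ratio i : R := if i is j.+1 then c j / c j.+2 else 0.

Lemma cheb_ratio_le m i : (forall j, (j <= m)%N -> 0 < c j) -> (i < m.-1)%N ->
  cheb_ratio i <= cheb_ratio i.+1.
Proof.
case: i => [|i] c_gt0 im; rewrite /=.
  by rewrite divr_ge0// ltW// c_gt0//; lia.
rewrite ler_pdivrMr ?c_gt0//; last lia.
by rewrite mulrAC ler_pdivlMr ?cheb_turan// c_gt0//; lia.
Qed.

Lemma cheb_ratio_ge0 m : (forall j, (j <= m)%N -> 0 < c j) ->
  0 <= cheb_ratio m.-1.
Proof.
move=> c_gt0; case: m c_gt0 => [|[|m]]//= c_gt0.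
by rewrite divr_ge0// ltW// c_gt0; lia.
Qed.

Section Step.
Variables (Z : nat -> R -> R) (T : R).
Hypotheses (ZSS : forall i, Z i.+2 = Z i) (Z0 : forall i, Z i 0 = 0)
  (Zcont : forall i, {within `[0, T], continuous (Z i)}).

Let Zbnd i : exists M, forall x, 0 <= x <= T -> `|Z i x| <= M.
Proof. exact: within_itv_bounded. Qed.

Let Zbnd1 i : exists M, forall x, 0 <= x <= T -> `|Z i.+1 x| <= M.
Proof. exact: Zbnd. Qed.

Lemma chain_sum_rec m s :
  Z 0%N (s 0%N) + 2 * rho * chain_sum m.+1 c (fun i => Z i.+1) (s \o S) =
  chain_sum m.+2 c Z s + chain_sum m c Z (s \o S \o S).
Proof.
rewrite /chain_sum (big_nat_recl m.+1)//= c0 mul1r -addrA; congr (_ + _).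
rewrite !(big_nat_recl m)//= c0 c1 mulrDr -addrA; congr (_ + _); first by ring.
rewrite mulr_sumr -big_split/=; apply: eq_bigr => i _.
by rewrite cSS ZSS; ring.
Qed.

(* Replacing the tail of [s] by that of [u] cannot improve the nearly optimal
   [s]; since the ratios [c i / c i.+2] are nondecreasing, Abel summation turns
   these inequalities with weights [c i.+2] into one with weights [c i]. *)
Lemma chain_sum_transfer m t t' s u e : t' <= t -> t <= T ->
  (forall i, (i <= m)%N -> 0 < c i) ->
  chain m.+2 t s -> chain m t' u -> (forall j, (j < m)%N -> u j < s j.+1) ->
  ((0 < m)%N -> Z m.-1 (s m.+1) <= Z m.-1 (u m.-1)) ->
  chain_sum m.+2 c Z s <= chain_inf m.+2 c Z t + e ->
  chain_sum m c Z (s \o S \o S) <= chain_sum m c Z u + cheb_ratio m.-1 * e.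
Proof.
move=> t't tT; case: m => [|m] c_gt0 cs cu us last_le s_opt.
  by rewrite /chain_sum !big_nil mul0r addr0.
have [s0 s_ge0 sS sm] := cs; have [u0 u_ge0 uS um] := cu.
pose d i := Z i (u i) - Z i (s i.+2).
have suffix k : (k <= m)%N -> - e <= \sum_(k <= i < m.+1) c i.+2 * d i.
  (* [w] follows [s] up to index [k.+1], then [u] from index [k]; by [us] it decreases at the
     junction. *)
  move=> km; pose w i := if (i < k.+2)%N then s i else u i.-2.
  have cw : chain m.+3 t w.
    rewrite /w; split=> [//|i|i|i ni].
    - by case: ifP.
    - have [ik|] := ltnP i k.+1; first by rewrite !ifT ?sS; lia.
      rewrite leq_eqVlt => /predU1P[<-|ki].
        by rewrite ltnn ltnS leqnn ltW// us.
      rewrite !ifN; try lia.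
      by case: i ki => [|[|i]] _ /=; rewrite ?lexx ?uS.
    - rewrite ifN; last by lia.
      by case: i ni => [|[|i]]// ni; rewrite um.
  have <- : chain_sum m.+3 c Z w - chain_sum m.+3 c Z s =
      \sum_(k <= i < m.+1) c i.+2 * d i.
    rewrite /chain_sum -sumrB (@big_cat_nat _ _ _ k.+2)//=; last lia.
    rewrite big_nat_cond big1 ?add0r => [|i /andP[/andP[_ ik] _]]; last first.
      by rewrite /w ik subrr.
    rewrite -[X in \sum_(X <= _ < _) _]addn2 big_addn !subSS subn0.
    apply: eq_big_nat => i /andP[ki _].
    by rewrite addn2 /w ifN ?ZSS ?mulrBr//; lia.
  by have := chain_inf_le c Zbnd tT cw; lra.
have := @abel_ge R m (c \o S \o S) c d cheb_ratio e.
rewrite /= mul0r subr0 add0r => abel.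
have : - (cheb_ratio m * e) <= \sum_(0 <= i < m.+1) c i * d i.
  apply: abel => [i im|i im|||//].
  - exact: (@cheb_ratio_le m.+1).
  - by rewrite divfK// gt_eqF// c_gt0.
  (* At the last index [c m.+2] is not known to be positive, so [cheb_turan] replaces a division by
     it. *)
  - case: m c_gt0 {cs cu us last_le s_opt sm um suffix} => [|m] c_gt0 /=.
      by rewrite mul0r c0.
    by rewrite mulrAC ler_pdivrMr ?cheb_turan// c_gt0.
  - by rewrite subr_ge0 last_le.
rewrite /chain_sum (eq_bigr (fun i => c i * Z i (u i) - c i * Z i (s i.+2))).
  by rewrite sumrB; lra.
by move=> i _; rewrite /d mulrBr.
Qed.

Lemma chain_near_optimal m t t' e : 0 <= t' -> t' <= t -> t <= T ->
  (forall i, (i <= m)%N -> 0 < c i) -> 0 <= c m.+1 ->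
  chain_inf m.+2 c Z t + chain_inf m c Z t' <
    chain_inf m.+2 c Z t' + chain_inf m c Z t -> 0 < e ->
  exists s, [/\ chain m.+2 t s, t' < s 0%N,
    chain_sum m.+2 c Z s <= chain_inf m.+2 c Z t + e &
    chain_sum m c Z (s \o S \o S) <=
      chain_inf m c Z t' + (1 + cheb_ratio m.-1) * e].
Proof.
move=> t'0 t't tT c_gt0 cm CB e0.
have t'T := le_trans t't tT; have t0 := le_trans t'0 t't.
(* [eta] is the gap in the strict inequality [CB]; an error of at most [eta / 2] in each of the two
   chains still allows [chain_interlace]. *)
set eta := chain_inf m.+2 c Z t' + chain_inf m c Z t -
  (chain_inf m.+2 c Z t + chain_inf m c Z t').
have eta0 : 0 < eta by rewrite subr_gt0.
pose e' := Num.min e (eta / 2).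
have e'0 : 0 < e' by rewrite lt_min e0 divr_gt0.
have e'e : e' <= e by rewrite ge_min lexx.
have e'eta : e' <= eta / 2 by rewrite ge_min lexx orbT.
have t0T : 0 <= t <= T by rewrite t0.
have t'0T : 0 <= t' <= T by rewrite t'0.
have [s cs s_opt] := chain_inf_adherent c Zbnd m.+2 t0T e'0.
have [u cu u_opt] := chain_inf_adherent c Zbnd m t'0T e'0.
have s0t' : t' < s 0%N.
  (* Otherwise [s] is also a chain for [t'], which forces [eta < e']. *)
  rewrite ltNge; apply/negP => st'.
  have cs' : chain m.+2 t' s by have [] := cs; split.
  have := chain_inf_le c Zbnd t'T cs'.
  have := chain_inf_anti c Zbnd m t'0 t't tT.
  by rewrite /eta in eta0 e'eta; lra.
have us : forall j, (j < m)%N -> u j < s j.+1.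
  apply: (chain_interlace Zbnd t't tT cs cu s0t').
  by rewrite /eta in eta0 e'eta; lra.
(* [c m.+1] may vanish, so [s] need not control the value of [Z] at its last
   point: that point is moved to the last one of [u] if this is better. *)
pose v i := if (i == m.+1) && (0 < m)%N && (Z m.-1 (u m.-1) < Z m.-1 (s m.+1))
  then u m.-1 else s i.
have vE i : (i <= m)%N -> v i = s i by move=> im; rewrite /v ltn_eqF.
have v_le : chain_sum m.+2 c Z v <= chain_sum m.+2 c Z s.
  rewrite /chain_sum !(big_nat_recr m.+1)//= lerD//.
    rewrite le_eqVlt; apply/orP; left; apply/eqP; apply: eq_big_nat => i.
    by rewrite ltnS => /andP[_ im]; rewrite vE.
  rewrite ler_wpM2l// /v eqxx/=; case: ifP => // /andP[m0 /ltW].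
  by case: (m) m0 => // k _; rewrite ZSS.
have cv : chain m.+2 t v.
  have [? s_ge0 sS sm] := cs; have [? u_ge0 uS um] := cu; split.
  - by rewrite vE.
  - by move=> i; rewrite /v; case: ifP.
  - move=> i; have [im|] := ltnP i m; first by rewrite !vE// ltnW.
    rewrite leq_eqVlt => /predU1P[<-|]; last first.
      rewrite leq_eqVlt => /predU1P[<-|mi]; last first.
        by rewrite /v !gtn_eqF//= ltnW.
      by rewrite {1}/v gtn_eqF//= sm// /v; case: ifP.
    rewrite (vE m)// /v eqxx/=; case: ifP => // /andP[m0 _].
    by rewrite ltW// (lt_le_trans (us _ _)) ?prednK.
  - by move=> i mi; rewrite /v gtn_eqF//= sm.
have uv j : (j < m)%N -> u j < v j.+1 by move=> jm; rewrite vE// us.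
exists v; split => //; first by lra.
have last_le : (0 < m)%N -> Z m.-1 (v m.+1) <= Z m.-1 (u m.-1).
  by move=> m0; rewrite /v eqxx m0/=; case: ltP.
have v_opt : chain_sum m.+2 c Z v <= chain_inf m.+2 c Z t + e' by lra.
have := chain_sum_transfer t't tT c_gt0 cv cu uv last_le v_opt.
by have := ler_wpM2l (cheb_ratio_ge0 c_gt0) e'e; lra.
Qed.

(** Recombines near-minimizers by pointwise maximum and minimum; it gives the monotonicity of [E] in
    the next proof. *)
Lemma chain_inf_sub_mono m n t t' : (m <= n)%N -> 0 <= t -> t <= t' -> t' <= T ->
  chain_inf n c Z t' + chain_inf m c Z t <=
  chain_inf n c Z t + chain_inf m c Z t'.
Proof.
move=> mn t0 tt' t'T; apply/ler_addgt0Pr => d d0.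
have d20 : 0 < d / 2 by rewrite divr_gt0.
have tT : 0 <= t <= T by rewrite t0 (le_trans tt').
have t'0T : 0 <= t' <= T by rewrite (le_trans t0).
have [s cs s_opt] := chain_inf_adherent c Zbnd n tT d20.
have [u cu u_opt] := chain_inf_adherent c Zbnd m t'0T d20.
rewrite (le_trans (chain_inf_maxmin c Zbnd mn tt' t'T cs cu))//.
by rewrite [d]splitr addrACA lerD// ltW.
Qed.

Lemma chain_inf_step_le m t e : 0 <= t <= T ->
  (forall i, (i <= m)%N -> 0 < c i) -> 0 <= c m.+1 -> 0 < e ->
  exists2 s, 0 <= s <= t &
    Z 0%N s + 2 * rho * chain_inf m.+1 c (fun i => Z i.+1) s
      - 2 * chain_inf m c Z s <=
    chain_inf m.+2 c Z t - chain_inf m c Z t +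
    (3 + cheb_ratio m.-1 + 2 * (\sum_(0 <= i < m.+2) `|c i|)
      + 2 * \sum_(0 <= i < m) `|c i|) * e.
Proof.
move=> /andP[t0 tT] c_gt0 cm e0.
set K1 := \sum_(0 <= i < m.+2) `|c i|; set K2 := \sum_(0 <= i < m) `|c i|.
have K1_ge0 : 0 <= K1 by exact: sumr_ge0.
have K2_ge0 : 0 <= K2 by exact: sumr_ge0.
have r0 := cheb_ratio_ge0 c_gt0.
pose E s := chain_inf m c Z s - chain_inf m.+2 c Z s.
have E_mono x x' : 0 <= x -> x <= x' -> x' <= t -> E x <= E x'.
  move=> x0 xx' x't; rewrite /E; have x'T := le_trans x't tT.
  have mm : (m <= m.+2)%N by rewrite leqW.
  by have := chain_inf_sub_mono mm x0 xx' x'T; lra.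
(* [E] vanishes at [0], so in the first case [E t < e], and the point [0], where the left side is
   [0], is good enough. *)
have [E0|E0] := ltP (E t - e) (E 0).
  exists 0; first by rewrite lexx.
  have C0 k : chain_inf k c Z 0 = 0 by exact: chain_inf0.
  have A0 : chain_inf m.+1 c (fun i => Z i.+1) 0 = 0 by exact: chain_inf0.
  move: E0; rewrite /E A0 Z0 !C0 => E0.
  have : 0 <= (2 + cheb_ratio m.-1 + 2 * K1 + 2 * K2) * e.
    by rewrite mulr_ge0 ?ltW//; lra.
  by lra.
have Ee : E t - e < E t by lra.
have [z /andP[z0 zt] near_z] := jump_point t0 E_mono E0 Ee.
have zT : 0 <= z <= T by rewrite z0 (le_trans zt).
have [d d0 Zd] : exists2 d, 0 < d &
    forall i x, 0 <= x <= T -> `|x - z| < d -> `|Z i x - Z i z| < e.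
  have [d d0 Zd] := within_itv_dist (@Zcont 0%N) zT e0.
  have [d' d'0 Zd'] := within_itv_dist (@Zcont 1%N) zT e0.
  exists (Num.min d d'); first by rewrite lt_min d0.
  move=> i x xT; rewrite lt_min => /andP[xd xd'].
  have [//] : `|Z i x - Z i z| < e /\ `|Z i.+1 x - Z i.+1 z| < e.
  elim: i => [|i [? ?]]; first by split; [exact: Zd|exact: Zd'].
  by rewrite ZSS.
(* [E] increases between the close points [s'] and [s]; the value at [s'] is
   estimated with the chain for [s] truncated at [s']. *)
have [s' [s [[s'0 s's st s'z sz] /andP[Es' Es]]]] := near_z _ d0.
have sT := le_trans st tT; have s'T := le_trans s's sT.
exists s'; first by rewrite s'0 (le_trans s's).
have CB : chain_inf m.+2 c Z s + chain_inf m c Z s' <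
    chain_inf m.+2 c Z s' + chain_inf m c Z s.
  by move: Es' Es; rewrite /E; lra.
have [w [cw w0 w_opt w_tail]] := chain_near_optimal s'0 s's sT c_gt0 cm CB e0.
(* Truncation moves only entries between [s'] and [s]; these and [s'] are all [d]-close to [z],
   which costs [e] twice. *)
have Zw i j : `|Z i (Num.min (w j) s') - Z i (w j)| <= 2 * e.
  have [ws'|s'w] := leP (w j) s'; first by rewrite subrr normr0 mulr_ge0// ltW.
  have ws := chain_le j cw.
  have wz : `|w j - z| < d by move: s'z sz; rewrite !ltr_norml; lra.
  have wT : 0 <= w j <= T by apply/andP; lra.
  have s'T' : 0 <= s' <= T by rewrite s'0.
  have := Zd i _ wT wz; have := Zd i _ s'T' s'z.
  by rewrite !ltr_norml ler_norml; lra.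
pose v i := Num.min (w i) s'.
have cv : chain m.+2 s' v by exact: chain_min cw.
have v0 : v 0%N = s' by rewrite /v min_r// ltW.
(* In the final constant, truncation accounts for [2 * K1 + 2 * K2], near-optimality of [w] and of
   its tail for [2 + cheb_ratio m.-1], and [Es] for [1]. *)
have := chain_sum_rec m v; rewrite v0.
have := @chain_sum_min R m.+2 c Z w s' (2 * e) (fun i => Zw i i).
have := @chain_sum_min R m c Z (w \o S \o S) s' (2 * e) (fun i => Zw i i.+2).
have A_le : chain_inf m.+1 c (fun i => Z i.+1) s' <=
    chain_sum m.+1 c (fun i => Z i.+1) (v \o S).
  by apply: (chain_inf_le c Zbnd1 s'T); have := chain_shift cv; rewrite v0.
have B_le := chain_inf_anti c Zbnd m s'0 s's sT.
have := ler_wpM2l (mulr_ge0 (ler0n R 2) rho_ge0) A_le.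
rewrite -/K1 -/K2 -/(chain_sum _ _ _ v) -/v.
rewrite -[X in X <= _ + K2 * _]/(chain_sum m c Z (v \o S \o S)).
move: Es; rewrite /E => Es.
by lra.
Qed.

Lemma chain_inf_step m t : 0 <= t <= T ->
  (forall i, (i <= m)%N -> 0 < c i) -> 0 <= c m.+1 ->
  inf [set (Z 0%N s + 2 * rho * chain_inf m.+1 c (fun i => Z i.+1) s
      - 2 * chain_inf m c Z s) | s in `[0, t]] =
  chain_inf m.+2 c Z t - chain_inf m c Z t.
Proof.
move=> tT c_gt0 cm; have /andP[t0 t_le] := tT; set F := [set _ | _ in _].
have lbF : lbound F (chain_inf m.+2 c Z t - chain_inf m c Z t).
  move=> _ [s + <-]; rewrite /= in_itv/= => /andP[s0 st].
  apply/ler_addgt0Pr => e e0; have sT : 0 <= s <= T by rewrite s0 (le_trans st).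
  have r1 : 0 < 1 + 2 * rho by rewrite ltr_pwDl// mulr_ge0.
  (* The error of [u] will enter with factor [2 * rho], that of [w] with factor [1]. *)
  have d0 : 0 < e / (1 + 2 * rho) by rewrite divr_gt0.
  have [u cu u_opt] := chain_inf_adherent c Zbnd1 m.+1 sT d0.
  have [w cw w_opt] := chain_inf_adherent c Zbnd m tT d0.
  have cu' := chain_cons s0 cu.
  (* The bound [chain_inf m c Z s] arises once from the maximum-minimum exchange and once from
     dropping the first entry of [u]; together these offset the term with factor [- 2]. *)
  have := chain_sum_rec m (fun i => if i is j.+1 then u j else s).
  have mm : (m <= m.+2)%N by rewrite leqW.
  have := chain_inf_maxmin c Zbnd mm st t_le cu' cw.
  have : chain_inf m c Z s <= chain_sum m c Z (u \o S).
    apply: (chain_inf_le c Zbnd) => //; first by case/andP: sT.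
    have := chain_shift cu; case=> ? ? ? ?; split => //=.
    by case: cu => u0 _ uS _; rewrite (le_trans (uS _)).
  have := ler_wpM2l (mulr_ge0 (ler0n R 2) rho_ge0) (ltW u_opt).
  rewrite /comp/=.
  have : (1 + 2 * rho) * (e / (1 + 2 * rho)) = e.
    by rewrite mulrCA divff ?mulr1// gt_eqF.
  by lra.
have F0 : F !=set0 by eexists; exists 0 => //=; rewrite in_itv/= lexx.
apply/le_anti; rewrite lb_le_inf// andbT.
apply/ler_addgt0Pr => e e0.
set K := 3 + cheb_ratio m.-1 + 2 * (\sum_(0 <= i < m.+2) `|c i|) +
  2 * \sum_(0 <= i < m) `|c i|.
have K0 : 0 < K.
  rewrite /K -!addrA ltr_pwDl// !addr_ge0 ?cheb_ratio_ge0 ?mulr_ge0 ?sumr_ge0//.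
have [|s st] := @chain_inf_step_le m t (e / K) tT c_gt0 cm.
  by rewrite divr_gt0.
rewrite -/K mulrCA divff ?gt_eqF// mulr1; apply: le_trans.
by apply: ge_inf; [eexists; exact: lbF|exists s].
Qed.

End Step.
End Chebyshev.

(** * Chebyshev values and Pitman transforms *)

Lemma cheb_inf_chain (R : realType) m (rho : R) (Z : nat -> R -> R) t :
  cheb_inf m rho Z t = chain_inf m (fun i => (tcheb R i).[rho]) Z t.
Proof.
rewrite /cheb_inf /chain_inf; congr inf; apply/seteqP; split.
  move=> _ [s /(pathP 0) cs <-].
  (* The appended [0] agrees with the default value of [nth], hence with the padding of chains. *)
  have nthE i : nth 0 (rcons s 0) i = nth 0 s i.
    by rewrite nth_rcons; case: ltngtP => // si; rewrite nth_default ?si// ltnW.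
  have sS i : nth 0 s i.+1 <= nth 0 s i.
    have [im|mi] := ltnP i m; last by rewrite !nth_default// size_tuple// leqW.
    by have := cs i.+1; rewrite size_rcons size_tuple /= !nthE => /(_ im).
  exists (nth 0 s); last first.
    by rewrite /chain_sum big_mkord; apply: eq_bigr => i _; rewrite (tnth_nth 0).
  split=> // [|i|i mi].
  - by have := cs 0%N; rewrite size_rcons /= nthE; exact.
  - have [im|mi] := ltnP i m; last by rewrite nth_default// size_tuple.
    move/nonincreasing_seqP : sS => /(_ i m (ltnW im)).
    by rewrite [X in X <= _]nth_default// size_tuple.
  - by rewrite nth_default// size_tuple.
move=> _ [s cs <-]; have [s0 s_ge0 sS sm] := cs.
have nthE i : nth 0 [tuple s i | i < m] i = s i.
  have [im|mi] := ltnP i m; last by rewrite sm// nth_default// size_tuple.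
  by rewrite -(tnth_nth 0 _ (Ordinal im)) tnth_mktuple.
exists [tuple s i | i < m]; last first.
  by rewrite /chain_sum big_mkord; apply: eq_bigr => i _; rewrite tnth_mktuple.
apply/(pathP 0) => i _; have nthE' j : nth 0 (rcons [tuple s i | i < m] 0) j = s j.
  rewrite nth_rcons nthE size_tuple.
  by case: ltngtP => // mj; rewrite sm// ?mj// ltnW.
by rewrite nthE'; case: i => [|i] //=; rewrite nthE'.
Qed.

(** * Positivity of the Chebyshev values *)

Section ChebyshevPos.
Variables (R : realType) (rho : R) (c : nat -> R).
Hypotheses (rho_gt0 : 0 < rho) (c0 : c 0%N = 1) (c1 : c 1%N = 2 * rho)
  (cSS : forall i, c i.+2 = 2 * rho * c i.+1 - c i).

Lemma cheb_ge1 i : 1 <= rho -> 1 <= c i.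
Proof.
move=> rho1; suff [] : 1 <= c i /\ c i <= c i.+1 by [].
elim: i => [|i [ci cii]]; first by rewrite c0 c1; split => //; lra.
split; first exact: le_trans cii.
have : 0 <= (rho - 1) * c i.+1.
  by rewrite mulr_ge0// ?subr_ge0// (le_trans ler01)// (le_trans ci).
by rewrite cSS; lra.
Qed.

Lemma cheb_sin x i : cos x = rho -> c i * sin x = sin (i.+1%:R * x).
Proof.
move=> xE; suff [] : c i * sin x = sin (i.+1%:R * x) /\
  c i.+1 * sin x = sin (i.+2%:R * x) by [].
elim: i => [|i [ih0 ih1]].
  by rewrite c0 c1 !mul1r (mulr_natl x) sin_mulr2n -xE; split=> //; ring.
split=> //; rewrite cSS mulrBl ih0 -(mulrA _ (c i.+1)) ih1 -xE.
have -> : i.+3%:R * x = i.+2%:R * x + x.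
  by rewrite -[i.+3]addn1 natrD mulrDl mul1r.
have -> : i.+1%:R * x = i.+2%:R * x - x.
  by rewrite -[i.+2]addn1 natrD mulrDl mul1r addrK.
by rewrite sinB sinD; ring.
Qed.

(** For [rho < 1] and [x = acos rho], the bound on [rho] means [n%:R * x <= pi], and [cheb_sin]
    reads the sign of [c i] off [sin (i.+1%:R * x)]. For [1 <= rho] the values never drop below
    [1]. *)
Lemma cheb_pos n : (0 < n)%N -> cos (pi / n%:R) <= rho ->
  (forall i, (i < n)%N -> 0 <= c i) /\ (forall i, (i.+1 < n)%N -> 0 < c i).
Proof.
move=> n0 rho_ge; have [rho1|rho1] := leP 1 rho.
  split=> i _; first by rewrite (le_trans ler01)// cheb_ge1.
  by rewrite (lt_le_trans ltr01)// cheb_ge1.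
have rhoN1 : -1 <= rho by rewrite (le_trans (lerN10 _))// ltW.
have rho_in : -1 <= rho <= 1 by rewrite rhoN1 ltW.
have acos_in : 0 < acos rho < pi.
  by rewrite acos_gt0 ?rhoN1// acos_ltpi// (lt_trans (ltrN10 _)) ?ltW.
have /andP[acos0 acospi] := acos_in.
have cosE : cos (acos rho) = rho by rewrite acosK// in_itv.
have sin0 := sin_gt0_pi acos_in.
have n0' : 0 < n%:R :> R by rewrite ltr0n.
have acos_le : n%:R * acos rho <= pi.
  rewrite mulrC -ler_pdivlMr// leNgt; apply/negP => pi_lt.
  suff : rho < cos (pi / n%:R) by rewrite ltNge rho_ge.
  rewrite -{1}cosE ltr_cos// in_itv/= ?ltW//=.
    exact: lt_trans acospi.
  by rewrite divr_gt0 ?pi_gt0.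
have le_pi i : (i < n)%N -> i.+1%:R * acos rho <= pi.
  by move=> i_n; rewrite (le_trans _ acos_le)// ler_pM2r// ler_nat.
split=> i i_n.
  rewrite -(pmulr_lge0 _ sin0) cheb_sin// sin_ge0_pi// le_pi// andbT.
  by rewrite mulr_ge0// ltW.
rewrite -(pmulr_lgt0 _ sin0) cheb_sin// sin_gt0_pi// mulr_gt0//=.
by rewrite (lt_le_trans _ (le_pi _ i_n))// ltr_pM2r// ltr_nat.
Qed.

End ChebyshevPos.

(** * Alternating compositions of Pitman transforms *)

Lemma pitman_eq (R : realType) (V : lmodType R) (a : V)
    (av : {linear V -> R^o}) (p q : R -> V) t : 0 <= t ->
  (forall s, 0 <= s <= t -> p s = q s) -> pitman a av p t = pitman a av q t.
Proof.
move=> t0 pq; rewrite /pitman pq ?t0 ?lexx//; congr (_ - inf _ *: _).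
by apply: eq_imagel => s; rewrite /= in_itv/= => /pq ->.
Qed.

(** The transforms inside the outermost one start with [beta], so the induction exchanges the two
    roots and is generalized over them. *)
Lemma altcomp_pitman (R : realType) (V : topologicalLmodType R)
  (alpha beta : V) (alphav betav : {linear V -> R^o})
  (alphav_cont : continuous alphav) (betav_cont : continuous betav)
  (alphav_alpha : alphav alpha = 2%:R) (betav_beta : betav beta = 2%:R)
  (rho T : R) (alphav_beta : alphav beta = - (2 * rho))
  (betav_alpha : betav alpha = - (2 * rho)) (rho_gt0 : 0 < rho)
  (p : R -> V) (p_cont : {within `[0, T], continuous p}) (p0 : p 0 = 0)
  n (t : R) :
  let c i := (tcheb R i).[rho] in
  let Z := altfun (fun s => alphav (p s)) (fun s => betav (p s)) in
  (forall i, (i <= n)%N -> 0 <= c i) -> (forall i, (i < n)%N -> 0 < c i) ->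
  0 <= t <= T ->
  altcomp n.+1 (pitman alpha alphav) (pitman beta betav) p t =
    p t - chain_inf n.+1 c Z t *: alpha
        - chain_inf n c (fun i => Z i.+1) t *: beta.
Proof.
move=> c Z.
elim: n alpha beta alphav betav alphav_cont betav_cont alphav_alpha betav_beta
  alphav_beta betav_alpha @Z t => [|n ih] alpha beta alphav betav alphav_cont
  betav_cont alphav_alpha betav_beta alphav_beta betav_alpha Z t c_ge0 c_gt0 tT.
  have /andP[t0 _] := tT.
  rewrite (_ : chain_inf 0 _ _ _ = 0) ?scale0r ?subr0; last first.
    rewrite /chain_inf (_ : [set _ | _ in _] = [set 0]) ?inf1//.
    apply/seteqP; split=> [_ [s _ <-]|_ ->]; first by rewrite /chain_sum big_nil.
    by exists (fun=> 0); [exact: chain_cst0|rewrite /chain_sum big_nil].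
  rewrite /= /pitman; congr (_ - inf _ *: _); apply/seteqP; split.
    move=> _ [s + <-]; rewrite /= in_itv/= => /andP[s0 st].
    exists (fun i => if i is 0%N then s else 0); last first.
      by rewrite /chain_sum big_nat1 /c hornerE mul1r.
    by split => //; case.
  move=> _ [s [s0 s_ge0 sS s1] <-].
  exists (s 0%N); first by rewrite /= in_itv/= s_ge0.
  by rewrite /chain_sum big_nat1 /c hornerE mul1r.
have /andP[t0 tleT] := tT.
set W := altfun (fun s => betav (p s)) (fun s => alphav (p s)).
have WE i : W i.+1 = Z i by rewrite /W /Z /altfun /=; case: odd.
have ZE i : Z i.+1 = W i by rewrite /W /Z /altfun /=; case: odd.
have ZSS i : Z i.+2 = Z i by rewrite ZE WE.
have Zcont i : {within `[0, T], continuous (Z i)}.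
  by rewrite /Z /altfun; case: odd => x; apply: continuous_comp;
    by [exact: p_cont|exact: alphav_cont|exact: betav_cont].
have Z0 i : Z i 0 = 0 by rewrite /Z /altfun; case: odd; rewrite p0 linear0.
have c0 : c 0%N = 1 by rewrite /c /= hornerE.
have c1 : c 1%N = 2 * rho by rewrite /c /= !hornerE.
have cSS i : c i.+2 = 2 * rho * c i.+1 - c i by rewrite /c /= !hornerE.
rewrite [LHS](@pitman_eq _ _ _ _ _ (fun s => p s - chain_inf n.+1 c W s *: beta
    - chain_inf n c (fun i => W i.+1) s *: alpha)) //; last first.
  move=> s /andP[s0 st]; apply: ih => // [i i_n|i i_n|].
  - by rewrite c_ge0// ltnW.
  - by rewrite c_gt0// ltnW.
  - by rewrite s0 (le_trans st).
have -> : (fun i => W i.+1) = Z by apply/funext.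
have -> : (fun i => Z i.+1) = W by apply/funext.
have := @chain_inf_step R rho c (ltW rho_gt0) c0 c1 cSS Z T ZSS Z0 Zcont n t tT.
move=> /(_ c_gt0 (c_ge0 _ (leqnn _))).
have -> : (fun i => Z i.+1) = W by apply/funext.
rewrite /pitman => step.
(* [alphav] sends [beta] to [- (2 * rho)] and [alpha] to [2]; applied to the inner closed form it
   yields the function minimized in [chain_inf_step]. *)
rewrite (_ : [set _ | _ in _] = [set (Z 0%N s + 2 * rho * chain_inf n.+1 c W s
      - 2 * chain_inf n c Z s) | s in `[0, t]]); last first.
  apply: eq_imagel => s _; rewrite !linearB !linearZ/= alphav_beta alphav_alpha.
  by rewrite /Z /altfun/= /GRing.scale/=; ring.
by rewrite step scalerBl opprB addrA addrNK addrAC.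
Qed.

Theorem theorem2p5 (R : realType) (V : topologicalLmodType R)
  (alpha beta : V) (alphav betav : {linear V -> R^o})
  (alphav_cont : continuous alphav) (betav_cont : continuous betav)
  (alphav_alpha : alphav alpha = 2%:R) (betav_beta : betav beta = 2%:R)
  (alphav_beta : alphav beta = betav alpha) (alphav_beta_lt0 : alphav beta < 0)
  (rho : R) (rhoE : rho = - (2%:R^-1 * alphav beta))
  (n : nat) (n_gt0 : (0 < n)%N) (rho_ge : cos (pi / n%:R) <= rho)
  (T : R) (p : R -> V) (p_cont : {within `[0, T], continuous p})
  (p0 : p 0 = 0) (t : R) (t_in : t \in `[0, T]) :
  let X : R -> R := fun s => alphav (p s) in
  let Y : R -> R := fun s => betav (p s) in
  let Z := altfun X Y in
  altcomp n (pitman alpha alphav) (pitman beta betav) p t =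
    p t - cheb_inf n rho Z t *: alpha
        - cheb_inf n.-1 rho (fun i => Z i.+1) t *: beta.
Proof.
have rho_gt0 : 0 < rho by rewrite rhoE oppr_gt0 pmulr_rlt0// invr_gt0.
have alphav_betaE : alphav beta = - (2 * rho) by rewrite rhoE; field.
have [c_ge0 c_gt0] : (forall i, (i < n)%N -> 0 <= (tcheb R i).[rho]) /\
    (forall i, (i.+1 < n)%N -> 0 < (tcheb R i).[rho]).
  by apply: (cheb_pos rho_gt0) => // [||i]; rewrite /= !hornerE.
case: n n_gt0 {rho_ge} c_ge0 c_gt0 => // n _ c_ge0 c_gt0 X Y Z.
rewrite !cheb_inf_chain; apply: (@altcomp_pitman _ _ _ _ _ _ _ _ _ _ _ T) => //.
by rewrite -alphav_beta.
Qed.
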